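(* Let $d=6$, and consider orders of moduli consisting of three letters $P$ and three letters $N$ (these are the orders of moduli compatible with each of the sign patterns below; there are $20$ of them). (1) The sign pattern $\Sigma_{3,1,2,1}=(+,+,+,-,+,+,-)$ is realizable by and only by the orders of moduli $PPPNNN$, $PPNPNN$, $PPNNPN$, $PNPPNN$ and $NPPPNN$. (2) The sign pattern $\Sigma_{2,1,2,2}=(+,+,-,+,+,-,-)$ is realizable by and only by the orders of moduli $PNNPPN$, $NPPPNN$, $NPPNPN$, $NPPNNP$, $NPNPPN$ and $NNPPPN$. (3) The sign pattern $\Sigma_{2,2,2,1}=(+,+,-,-,+,+,-)$ is not realizable by and only by the following compatible orders of moduli: $NPNPNP$, $NPNNPP$, $NNPPNP$, $NNPNPP$ and $NNNPPP$ (that is, it is realizable by each of the other $15$ compatible orders of moduli and by none of these five). (4) The sign pattern $\Sigma_{3,2,1,1}=(+,+,+,-,-,+,-)$ is realizable by and only by the orders of moduli $PPPNNN$, $PPNPNN$, $PPNNPN$ and $PNPPNN$.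
   Context: A real univariate polynomial is hyperbolic if all its roots are real. Only hyperbolic polynomials with all coefficients non-vanishing are considered. The sign pattern of a degree $d$ real polynomial $Q=\sum_{j=0}^d q_jx^j$ with all $q_j\neq 0$ is the string $\sigma(Q)=(\mathrm{sgn}(q_d),\mathrm{sgn}(q_{d-1}),\ldots,\mathrm{sgn}(q_0))$. $\Sigma_{m_1,m_2,m_3,\ldots}$ denotes the sign pattern consisting of $m_1$ pluses, followed by $m_2$ minuses, followed by $m_3$ pluses, etc. By Descartes' rule of signs, a hyperbolic polynomial with non-vanishing coefficients has exactly as many positive (resp. negative) roots, counted with multiplicity, as there are sign changes (resp. sign preservations) in its sign pattern. If a hyperbolic degree $d$ polynomial has non-vanishing coefficients and its $d$ roots have pairwise distinct moduli, the order of moduli it defines is the string of $d$ letters obtained by listing the roots in increasing order of modulus and writing $P$ for a positive root and $N$ for a negative root. (E.g. if the roots are $-\gamma_3<-\gamma_2<-\gamma_1<0<\alpha_1<\alpha_2<\alpha_3$ with $\alpha_1<\gamma_1<\gamma_2<\alpha_2<\gamma_3<\alpha_3$, the order of moduli is $PNNPNP$.) An order of moduli is compatible with a sign pattern if its number of letters $P$ (resp. $N$) equals the number of sign changes (resp. sign preservations) of the sign pattern. A sign pattern $\sigma$ is realizable by an order of moduli $\Omega$ if there exists a degree $d$ hyperbolic polynomial with non-vanishing coefficients and with roots of pairwise distinct moduli whose sign pattern is $\sigma$ and whose order of moduli is $\Omega$. *)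

(* Defs.v *)
From HB Require Import structures.
From mathcomp Require Import all_boot all_order all_algebra.
From mathcomp Require Import complex reals.

Set Implicit Arguments.
Unset Strict Implicit.
Unset Printing Implicit Defensive.

Import Order.TTheory GRing.Theory Num.Theory.
Local Open Scope ring_scope.

Inductive letter := P | N.

Definition bool_of_letter (l : letter) : bool := if l is P then true else false.
Definition letter_of_bool (b : bool) : letter := if b then P else N.
Fact bool_of_letterK : cancel bool_of_letter letter_of_bool.
Proof. by case. Qed.
HB.instance Definition _ := Finite.copy letter (can_type bool_of_letterK).

(* Sigma [:: m1; m2; m3; ...] is the sign pattern Sigma_{m1,m2,m3,...}; signs
   are encoded as the integers 1 and -1, leading coefficient first. *)
Fixpoint Sigma_from (e : int) (ms : seq nat) : seq int :=
  if ms is m :: ms' then nseq m e ++ Sigma_from (- e) ms' else [::].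
Definition Sigma (ms : seq nat) : seq int := Sigma_from 1 ms.

Definition sign_changes (sigma : seq int) : nat :=
  count (fun ab => ab.1 != ab.2) (zip sigma (behead sigma)).
Definition sign_preservations (sigma : seq int) : nat :=
  count (fun ab => ab.1 == ab.2) (zip sigma (behead sigma)).

Definition compatible (Omega : seq letter) (sigma : seq int) : Prop :=
  count_mem P Omega = sign_changes sigma
  /\ count_mem N Omega = sign_preservations sigma.

Section Realizability.
Variable R : realType.
Implicit Types (Q : {poly R}) (s : seq R).

Definition hyperbolic Q : Prop :=
  forall z : R[i], root (map_poly (real_complex R) Q) z -> complex.Im z = 0.

(* The coefficient list of Q starts with the constant term, hence the rev. *)
Definition sign_pattern Q : seq int := [seq sgz c | c <- rev Q].

(* s lists the roots of Q, all real, repeated according to multiplicity. *)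
Definition root_list Q s : Prop :=
  Q = lead_coef Q *: \prod_(x <- s) ('X - x%:P).

Definition root_letter (x : R) : letter := if 0 < x then P else N.

(* Strict sortedness makes the moduli pairwise distinct.  The letter N is used
   only for Q with Q.[0] != 0, so that nonpositive roots are negative. *)
Definition order_of_moduli Q (Omega : seq letter) : Prop :=
  exists s, [/\ root_list Q s,
                sorted (fun x y => `|x| < `|y|) s
              & Omega = map root_letter s].

Definition realizable (d : nat) (sigma : seq int) (Omega : seq letter) : Prop :=
  exists Q, [/\ size Q = d.+1,
                hyperbolic Q,
                forall j, (j <= d)%N -> Q`_j != 0,
                sign_pattern Q = sigma
              & order_of_moduli Q Omega].

End Realizability.

Arguments realizable R d%_N sigma Omega.

Fact SigmaE :
  [/\ Sigma [:: 3; 1; 2; 1]%N = [:: 1; 1; 1; -1; 1; 1; -1],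
      Sigma [:: 2; 1; 2; 2]%N = [:: 1; 1; -1; 1; 1; -1; -1],
      Sigma [:: 2; 2; 2; 1]%N = [:: 1; 1; -1; -1; 1; 1; -1]
    & Sigma [:: 3; 2; 1; 1]%N = [:: 1; 1; 1; -1; -1; 1; -1]].
Proof. by []. Qed.

Fact compatibleE (Omega : seq letter) (ms : seq nat) :
  ms \in [:: [:: 3; 1; 2; 1]; [:: 2; 1; 2; 2];
             [:: 2; 2; 2; 1]; [:: 3; 2; 1; 1]]%N ->
  compatible Omega (Sigma ms) <->
  count_mem P Omega = 3%N /\ count_mem N Omega = 3%N.
Proof. by rewrite !inE => /or4P[] /eqP->. Qed.

Fact compatible_orders (Omega : seq letter) :
  count_mem P Omega = 3%N /\ count_mem N Omega = 3%N <->
  Omega \in permutations [:: P; P; P; N; N; N].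
Proof.
rewrite mem_permutations; split=> [[hP hN]|/permP h]; last by rewrite !h.
by apply/allP => -[] _ /=; rewrite ?hP ?hN.
Qed.

Fact number_compatible_orders :
  size (permutations [:: P; P; P; N; N; N]) = 20%N.
Proof. by []. Qed.

(* Main.v *)
Require Import Defs.
From mathcomp Require Import all_boot all_order all_algebra.
From mathcomp Require Import complex reals.
From mathcomp Require Import ring lra.

(* Let a1 < a2 < a3 and g1 < g2 < g3 be the moduli of the positive and of the
   negative roots, with elementary symmetric functions e_i and f_i.  The
   coefficients are q5 = f1 - e1, q4 = f2 - e1 f1 + e2,
   q3 = f3 - e1 f2 + e2 f1 - e3, q2 = e2 f2 - e1 f3 - e3 f1,
   q1 = e2 f3 - e3 f2 and q0 = - e3 f3, so every exclusion is an inequality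
   between the a_i and the g_i:
   - if e1 < f1, then e2 + f2 <= e1 f1 as soon as g3 <= a3 or g1 + g2 <= e1,
     which excludes orders for the patterns starting with +++;
   - passing to inverses of the roots, if q1 > 0 and g1 <= a1, then q2 >= 0;
   - q5 > 0 is violated if g_i < a_i for all i, and q1 < 0 if a_i < g_i for
     all i;
   - if a1 < g1 and g3 < a3, the odd part of the polynomial is positive at a1
     and negative at a3; divided by x it is a quadratic in x^2, convex when
     q5 > 0, so q1 > 0.
   The remaining orders are realized by explicit integer moduli. *)

Import Order.TTheory GRing.Theory Num.Theory.

Set Implicit Arguments.
Unset Strict Implicit.
Unset Printing Implicit Defensive.

Local Notation sym1 x y z := (x + y + z)%R (only parsing).
Local Notation sym2 x y z := (x * y + x * z + y * z)%R (only parsing).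
Local Notation sym3 x y z := (x * y * z)%R (only parsing).

(** * Inequalities between the elementary symmetric functions of the two triples of moduli *)

Section Inequalities.
Local Open Scope ring_scope.
Variable R : realFieldType.

(** With h_i = a3 - g_i >= 0, u = a1 + a2 and h the sum of the h_i, the right side minus the left
    one is a3 (h + 2u) - uh - a1 a2 - (h1 h2 + h1 h3 + h2 h3). The hypothesis on the sums reads h +
    u < 2 a3; the bounds u^2/4 and h^2/3 on the last two terms conclude. *)
Lemma sym2_le_max (a1 a2 a3 g1 g2 g3 : R) :
    0 < a1 -> 0 < a2 -> g1 <= a3 -> g2 <= a3 -> g3 <= a3 ->
    sym1 a1 a2 a3 < sym1 g1 g2 g3 ->
  sym2 a1 a2 a3 + sym2 g1 g2 g3 <= sym1 a1 a2 a3 * sym1 g1 g2 g3.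
Proof.
move=> a1_gt0 a2_gt0 le1 le2 le3 lt_sum.
pose h1 := a3 - g1; pose h2 := a3 - g2; pose h3 := a3 - g3.
pose u := a1 + a2; pose h := h1 + h2 + h3.
have h_ge0 : 0 <= h by rewrite /h /h1 /h2 /h3; lra.
have u_ge0 : 0 <= u by rewrite /u; lra.
have: 0 <= (a3 *+ 2 - h - u) * (h + u *+ 2).
  by apply: mulr_ge0; rewrite /h /h1 /h2 /h3 /u; lra.
have := mulr_ge0 h_ge0 u_ge0; have := mulr_ge0 u_ge0 u_ge0.
have := mulr_ge0 h_ge0 h_ge0.
have := sqr_ge0 (a1 - a2).
have := sqr_ge0 (h1 - h2); have := sqr_ge0 (h1 - h3); have := sqr_ge0 (h2 - h3).
by rewrite /h /h1 /h2 /h3 /u; lra.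
Qed.

(** Put s = g1 + g2. As s <= e1 < f1, the difference f1 (e1 - s) + s^2 - e2 - g1 g2 is at least e1
    (e1 - s) + s^2 - e1^2/3 - s^2/4, a positive definite quadratic form in e1 and s. *)
Lemma sym2_le_pair (a1 a2 a3 g1 g2 g3 : R) :
    g1 + g2 <= sym1 a1 a2 a3 -> sym1 a1 a2 a3 < sym1 g1 g2 g3 ->
  sym2 a1 a2 a3 + sym2 g1 g2 g3 <= sym1 a1 a2 a3 * sym1 g1 g2 g3.
Proof.
move=> le_pair lt_sum.
have: 0 <= (sym1 a1 a2 a3 - (g1 + g2)) * (sym1 g1 g2 g3 - sym1 a1 a2 a3).
  by apply: mulr_ge0; lra.
have := sqr_ge0 (sym1 a1 a2 a3); have := sqr_ge0 (g1 - g2).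
have := sqr_ge0 (3 * (g1 + g2) - 2 * sym1 a1 a2 a3).
have := sqr_ge0 (a1 - a2); have := sqr_ge0 (a1 - a3); have := sqr_ge0 (a2 - a3).
by lra.
Qed.

(** Inversion makes g1 the source of the largest modulus, so this is [sym2_le_max] for the inverses
    with the two triples exchanged. *)
Lemma sym2_le_min (a1 a2 a3 g1 g2 g3 : R) :
    0 < g1 -> g1 <= a1 -> g1 <= a2 -> g1 <= a3 -> 0 < g2 -> 0 < g3 ->
    sym3 a1 a2 a3 * sym2 g1 g2 g3 < sym2 a1 a2 a3 * sym3 g1 g2 g3 ->
  sym1 a1 a2 a3 * sym3 g1 g2 g3 + sym3 a1 a2 a3 * sym1 g1 g2 g3 <=
  sym2 a1 a2 a3 * sym2 g1 g2 g3.
Proof.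
move=> g1_gt0 le1 le2 le3 g2_gt0 g3_gt0.
have [a1_gt0 a2_gt0 a3_gt0] : [/\ 0 < a1, 0 < a2 & 0 < a3] by split; lra.
have nz (x : R) : 0 < x -> x != 0 by exact: lt0r_neq0.
have c_gt0 : 0 < sym3 a1 a2 a3 * sym3 g1 g2 g3 by rewrite !mulr_gt0.
have leV (x : R) : g1 <= x -> x^-1 <= g1^-1.
  by move=> lex; rewrite lef_pV2 // posrE; lra.
have := @sym2_le_max g3^-1 g2^-1 g1^-1 a1^-1 a2^-1 a3^-1.
rewrite !invr_gt0 => /(_ g3_gt0 g2_gt0 (leV _ le1) (leV _ le2) (leV _ le3)).
(* Multiplying by e3 f3 clears all denominators. *)
rewrite -(ltr_pM2l c_gt0) -(ler_pM2l c_gt0).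
set l1 := (X in X < _ -> _); set l2 := (X in _ < X -> _).
set l3 := (X in _ -> X <= _); set l4 := (X in _ -> _ <= X).
have -> : l1 = sym3 a1 a2 a3 * sym2 g1 g2 g3.
  by rewrite /l1; field; rewrite !nz.
have -> : l2 = sym2 a1 a2 a3 * sym3 g1 g2 g3.
  by rewrite /l2; field; rewrite !nz.
have -> : l3 = sym1 a1 a2 a3 * sym3 g1 g2 g3 + sym3 a1 a2 a3 * sym1 g1 g2 g3.
  by rewrite /l3; field; rewrite !nz.
have -> // : l4 = sym2 a1 a2 a3 * sym2 g1 g2 g3.
by rewrite /l4; field; rewrite !nz.
Qed.

Lemma inner_triple_le (a1 a2 a3 g1 g2 g3 : R) :
    0 < a1 -> a1 < a2 -> a2 < a3 -> a1 < g1 -> a1 < g2 -> a1 < g3 ->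
    g1 < a3 -> g2 < a3 -> g3 < a3 ->
    sym1 a1 a2 a3 < sym1 g1 g2 g3 ->
  sym3 a1 a2 a3 * sym2 g1 g2 g3 <= sym2 a1 a2 a3 * sym3 g1 g2 g3.
Proof.
move=> a1_gt0 lt12 lt23 gt1 gt2 gt3 lt1 lt2 lt3 lt_sum.
rewrite -subr_ge0 leNgt; apply/negP => q1_lt0.
pose q5 := sym1 g1 g2 g3 - sym1 a1 a2 a3.
pose q3 := sym3 g1 g2 g3 - sym1 a1 a2 a3 * sym2 g1 g2 g3
  + sym2 a1 a2 a3 * sym1 g1 g2 g3 - sym3 a1 a2 a3.
set q1 := (X in X < 0) in q1_lt0.
(* [o x] is the odd part divided by x. At a root x the odd part is minus half the value of the
   polynomial at -x, whence the factorizations at a1 and a3. *)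
pose o x : R := q5 * x ^+ 4 + q3 * x ^+ 2 + q1.
have o1 : 0 < o a1 * a1 *+ 2.
  have -> : o a1 * a1 *+ 2 = (a1 + a1) * (a1 + a2) * (a1 + a3) *
     ((g1 - a1) * (g2 - a1) * (g3 - a1)) by rewrite /o /q5 /q3 /q1; ring.
  by rewrite !mulr_gt0 ?subr_gt0 //; lra.
have o3 : 0 < - o a3 * a3 *+ 2.
  have -> : - o a3 * a3 *+ 2 = (a1 + a3) * (a2 + a3) * (a3 + a3) *
     ((a3 - g1) * (a3 - g2) * (a3 - g3)) by rewrite /o /q5 /q3 /q1; ring.
  by rewrite !mulr_gt0 ?subr_gt0 //; lra.
have a3_gt0 : 0 < a3 by lra.
rewrite pmulrn_lgt0 // pmulr_lgt0 // in o1.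
rewrite pmulrn_lgt0 // pmulr_lgt0 // oppr_gt0 in o3.
have lt_sqr : 0 < a3 ^+ 2 - a1 ^+ 2.
  by rewrite subr_sqr mulr_gt0 //; lra.
have sqr1 : 0 < a1 ^+ 2 by rewrite exprn_gt0.
have sqr3 : 0 < a3 ^+ 2 by rewrite exprn_gt0.
have q5_gt0 : 0 < q5 by rewrite subr_gt0.
(* A convex quadratic in x^2 that is negative at 0 and at a3^2 cannot be positive at a1^2 in
   between: this combination eliminates q3 and is identically 0. *)
have : 0 < (a3 ^+ 2 * o a1 + a1 ^+ 2 * - o a3) +
    (- q1 * (a3 ^+ 2 - a1 ^+ 2) + q5 * a1 ^+ 2 * a3 ^+ 2 * (a3 ^+ 2 - a1 ^+ 2)).
  by rewrite !addr_gt0 // !mulr_gt0 ?oppr_gt0.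
set t := (X in 0 < X); have -> : t = 0 by rewrite /t /o; ring.
by rewrite ltxx.
Qed.

(** After division by e3 f3 the difference is the sum of the 1/a_i - 1/g_i, each nonnegative. *)
Lemma sym21_le (a1 a2 a3 g1 g2 g3 : R) :
    0 < a1 -> 0 < a2 -> 0 < a3 -> a1 <= g1 -> a2 <= g2 -> a3 <= g3 ->
  sym3 a1 a2 a3 * sym2 g1 g2 g3 <= sym2 a1 a2 a3 * sym3 g1 g2 g3.
Proof.
move=> a1_gt0 a2_gt0 a3_gt0 le1 le2 le3; rewrite -subr_ge0.
have -> : sym2 a1 a2 a3 * sym3 g1 g2 g3 -
    sym3 a1 a2 a3 * sym2 g1 g2 g3 =
  a1 * a2 * (g1 * g2) * (g3 - a3) + a1 * a3 * (g1 * g3) * (g2 - a2) +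
  a2 * a3 * (g2 * g3) * (g1 - a1) by ring.
by rewrite !addr_ge0 // !mulr_ge0 ?subr_ge0 //; lra.
Qed.
End Inequalities.

(** * Reduction of realizability to the choice of six moduli *)

Section Moduli.
Local Open Scope ring_scope.
Variable R : realType.
Implicit Types (Q p : {poly R}) (s m : seq R) (Omega : seq letter).

(* Leading coefficient first; a and g are lists of length 3. *)
Definition coefs_of_moduli (a g : seq R) : seq R :=
  let e1 := sym1 a`_0 a`_1 a`_2 in let f1 := sym1 g`_0 g`_1 g`_2 in
  let e2 := sym2 a`_0 a`_1 a`_2 in let f2 := sym2 g`_0 g`_1 g`_2 in
  let e3 := sym3 a`_0 a`_1 a`_2 in let f3 := sym3 g`_0 g`_1 g`_2 in
  [:: 1; f1 - e1; f2 - e1 * f1 + e2; f3 - e1 * f2 + e2 * f1 - e3;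
      e2 * f2 - e1 * f3 - e3 * f1; e2 * f3 - e3 * f2; - (e3 * f3)].

Definition pattern_of_moduli (a g : seq R) : seq int :=
  [seq sgz c | c <- coefs_of_moduli a g].

Lemma prod_moduliE (a g : seq R) : size a = 3%N -> size g = 3%N ->
  (\prod_(x <- a) ('X - x%:P)) * (\prod_(x <- g) ('X - (- x)%:P))
  = Poly (rev (coefs_of_moduli a g)).
Proof.
case: a => [|a1[|a2[|a3[|]]]] // _; case: g => [|g1[|g2[|g3[|]]]] // _.
rewrite unlock /= /rev /=.
rewrite !cons_poly_def !(rmorphD, rmorphN, rmorphB, rmorphM) /= ?polyC1.
by ring.
Qed.

Lemma sign_patternZ (c : R) p :
  0 < c -> sign_pattern (c *: p) = sign_pattern p.
Proof.
move=> c_gt0; rewrite /sign_pattern !map_rev; congr rev.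
apply: (@eq_from_nth _ 0); rewrite !size_map size_scale ?gt_eqF // => i lti.
by rewrite !(nth_map 0) ?size_scale ?gt_eqF // coefZ sgzM gtr0_sgz // mul1r.
Qed.

Lemma sign_pattern_head Q : sgz (lead_coef Q) = head 0 (sign_pattern Q).
Proof.
rewrite /sign_pattern -nth0; have [->|nzQ] := eqVneq Q 0.
  by rewrite lead_coef0 polyseq0 /= sgz0.
by rewrite (nth_map 0) ?nth_rev ?size_rev ?size_poly_gt0 // subn1.
Qed.

Lemma hyperbolic_prod s : hyperbolic (\prod_(x <- s) ('X - x%:P)).
Proof.
move=> z; rewrite rmorph_prod /root horner_prod => /eqP/eqP.
rewrite prodf_seq_eq0 => /hasP[x _]; rewrite rmorphB /= map_polyX map_polyC /=.
by rewrite !hornerE subr_eq0 => /eqP->.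
Qed.

Definition moduli_of_letter (l : letter) Omega m :=
  mask (map (pred1 l) Omega) m.

Lemma prod_root_letters s : all (fun x => x != 0) s ->
  \prod_(x <- s) ('X - x%:P) =
  (\prod_(x <- moduli_of_letter P (map (@root_letter R) s) (map Num.norm s))
      ('X - x%:P)) *
  (\prod_(x <- moduli_of_letter N (map (@root_letter R) s) (map Num.norm s))
      ('X - (- x)%:P)).
Proof.
elim: s => [|x s IHs] /=; first by rewrite !big_nil mulr1.
move=> /andP[nzx /IHs IH]; rewrite /moduli_of_letter /= big_cons {}IH.
rewrite /root_letter; case: ltrgt0P nzx => // x_gt0 _ /=;
  rewrite big_cons ?opprK.
  by rewrite mulrA.
by rewrite mulrCA.
Qed.

Definition signed_roots Omega m : seq R :=
  [seq (if lx.1 == P then lx.2 else - lx.2) | lx <- zip Omega m].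

Lemma signed_rootsK Omega m : all (fun x => 0 < x) m -> size Omega = size m ->
  map Num.norm (signed_roots Omega m) = m /\
  map (@root_letter R) (signed_roots Omega m) = Omega.
Proof.
rewrite /signed_roots; elim: m Omega => [|x m IHm] [|l Omega] //=.
move=> /andP[x_gt0 m_gt0] [eq_sz]; have [-> ->] := IHm Omega m_gt0 eq_sz.
case: l => /=; rewrite ?normrN gtr0_norm // /root_letter ?x_gt0 //.
by rewrite oppr_gt0 ltNge ltW.
Qed.

Lemma size_moduli_of_letter l Omega m :
  size Omega = size m -> size (moduli_of_letter l Omega m) = count_mem l Omega.
Proof.
by move=> eq_sz; rewrite size_mask ?size_map // count_map.
Qed.

(** A leading plus lets the polynomial be made monic without changing its pattern, so only the
    moduli remain to be chosen; the absence of 0 in [sigma] gives non-vanishing coefficients. *)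
Lemma realizableP (sigma : seq int) Omega :
    head 0 sigma = 1 -> 0 \notin sigma ->
    count_mem P Omega = 3%N -> count_mem N Omega = 3%N ->
  realizable R 6 sigma Omega <->
  exists m, [/\ size m = 6%N, all (fun x => 0 < x) m, sorted <%R m
    & pattern_of_moduli (moduli_of_letter P Omega m)
                        (moduli_of_letter N Omega m) = sigma].
Proof.
move=> hd_sigma nz_sigma countP countN.
have szOmega : size Omega = 6%N.
  rewrite -(count_predC (pred1 P)) countP.
  have /eq_count-> : predC (pred1 P) =1 pred1 N by case.
  by rewrite countN.
have coefsE s : size s = 6%N -> all (fun x => x != 0) s ->
    Omega = map (@root_letter R) s ->
    \prod_(x <- s) ('X - x%:P) = Poly (rev (coefs_of_moduli
      (moduli_of_letter P Omega (map Num.norm s))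
      (moduli_of_letter N Omega (map Num.norm s)))).
  move=> sz nz OmegaE; rewrite prod_root_letters // -OmegaE.
  have szm : size Omega = size (map Num.norm s) by rewrite size_map sz.
  by rewrite prod_moduliE // size_moduli_of_letter.
have patternE a g : sign_pattern (Poly (rev (coefs_of_moduli a g))) =
    pattern_of_moduli a g.
  (* The leading entry is 1, so [Poly] truncates nothing, even if other entries vanish. *)
  by rewrite /sign_pattern (PolyK (c := 1)) ?revK //= oner_neq0.
split=> [[Q [szQ _ nzQ patQ [s [rootsQ sorted_s OmegaE]]]]
       | [m [szm m_gt0 sorted_m patm]]].
  have c_gt0 : 0 < lead_coef Q.
    by rewrite -sgz_gt0 sign_pattern_head patQ hd_sigma.
  have szs : size s = 6%N.
    apply: succn_inj.
    by rewrite -(size_prod_XsubC s id) -szQ [in RHS]rootsQ size_scale ?gt_eqF.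
  have nzs : all (fun x => x != 0) s.
    (* A zero root would annihilate the constant coefficient. *)
    apply: contraLR (nzQ 0%N isT) => /allPn[x s_x]; rewrite !negbK => /eqP x0.
    rewrite -horner_coef0 rootsQ hornerZ mulf_eq0 -/(root _ _).
    by rewrite root_prod_XsubC -x0 s_x orbT.
  exists (map Num.norm s); split.
  - by rewrite size_map.
  - by rewrite all_map; apply: sub_all nzs => x /=; rewrite normr_gt0.
  - by rewrite sorted_map.
  - by rewrite -patternE -coefsE // -patQ [in RHS]rootsQ sign_patternZ.
have [] := signed_rootsK m_gt0 (etrans szOmega (esym szm)).
set s := signed_roots Omega m => normE lettersE.
have szs : size s = 6%N by rewrite -szm -normE [RHS]size_map.
have nzs : all (fun x => x != 0) s.
  move: m_gt0; rewrite -{1}normE all_map; apply: sub_all => x /=.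
  by rewrite normr_gt0.
have prodE := coefsE s szs nzs (esym lettersE); rewrite normE in prodE.
have patQ : sign_pattern (\prod_(x <- s) ('X - x%:P)) = sigma.
  by rewrite prodE patternE.
exists (\prod_(x <- s) ('X - x%:P)).
have szQ : size (\prod_(x <- s) ('X - x%:P)) = 7%N.
  by rewrite (size_prod_XsubC s id) szs.
split=> //; first exact: hyperbolic_prod.
  move=> j le_j; apply: contraNneq nz_sigma => qj0.
  rewrite -patQ; apply/mapP; exists 0; rewrite ?sgz0 // mem_rev -qj0.
  by rewrite mem_nth // szQ.
exists s; split=> //.
  by rewrite /root_list (monicP (monic_prod_XsubC _ _ _)) scale1r.
by move: sorted_m; rewrite -normE sorted_map.
Qed.
End Moduli.

(** * Exclusions and witnesses for the four sign patterns *)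

Section SignPatterns.
Local Open Scope ring_scope.
Variable R : realType.

Lemma sgz_eq1 (x : R) : sgz x = 1 -> 0 < x.
Proof. by move/eqP; rewrite sgz_cp0. Qed.

Lemma sgz_eqN1 (x : R) : sgz x = -1 -> x < 0.
Proof. by move/eqP; rewrite sgz_cp0. Qed.

Lemma pattern_pp_not_dominated (a1 a2 a3 g1 g2 g3 : R) sigma :
    pattern_of_moduli [:: a1; a2; a3] [:: g1; g2; g3] = [:: 1, 1 & sigma] ->
  g1 < a1 -> g2 < a2 -> g3 < a3 -> False.
Proof. by case=> _ /sgz_eq1 /= q5 _ *; lra. Qed.

Lemma pattern_ppp_max (a1 a2 a3 g1 g2 g3 : R) sigma :
    pattern_of_moduli [:: a1; a2; a3] [:: g1; g2; g3] = [:: 1, 1, 1 & sigma] ->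
    0 < a1 -> a1 < a2 -> g1 < g2 -> g2 < g3 ->
  g3 < a3 -> False.
Proof.
case=> _ /sgz_eq1 /= q5 /sgz_eq1 /= q4 _ a1_gt0 lt_a lt_g12 lt_g23 lt3.
have : sym2 a1 a2 a3 + sym2 g1 g2 g3 <= sym1 a1 a2 a3 * sym1 g1 g2 g3.
  by apply: sym2_le_max; lra.
by lra.
Qed.

Lemma pattern_ppp_pair (a1 a2 a3 g1 g2 g3 : R) sigma :
    pattern_of_moduli [:: a1; a2; a3] [:: g1; g2; g3] = [:: 1, 1, 1 & sigma] ->
    0 < a1 -> g1 < a2 -> g2 < a3 -> False.
Proof.
case=> _ /sgz_eq1 /= q5 /sgz_eq1 /= q4 _ a1_gt0 lt2 lt3.
have : sym2 a1 a2 a3 + sym2 g1 g2 g3 <= sym1 a1 a2 a3 * sym1 g1 g2 g3.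
  by apply: sym2_le_pair; lra.
by lra.
Qed.

Lemma Sigma3211_min (a1 a2 a3 g1 g2 g3 : R) :
    pattern_of_moduli [:: a1; a2; a3] [:: g1; g2; g3] = Sigma [:: 3; 2; 1; 1] ->
    0 < g1 -> g1 < g2 -> g2 < g3 -> a1 < a2 -> a2 < a3 ->
  g1 < a1 -> False.
Proof.
case=> _ _ _ _ /sgz_eqN1 /= q2 /sgz_eq1 /= q1 _.
move=> g1_gt0 lt_g12 lt_g23 lt_a12 lt_a23 lt1.
have : sym1 a1 a2 a3 * sym3 g1 g2 g3 + sym3 a1 a2 a3 * sym1 g1 g2 g3 <=
    sym2 a1 a2 a3 * sym2 g1 g2 g3.
  by apply: sym2_le_min; lra.
by lra.
Qed.

Lemma Sigma2122_not_dominating (a1 a2 a3 g1 g2 g3 : R) :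
    pattern_of_moduli [:: a1; a2; a3] [:: g1; g2; g3] = Sigma [:: 2; 1; 2; 2] ->
    0 < a1 -> a1 < a2 -> a2 < a3 ->
  a1 < g1 -> a2 < g2 -> a3 < g3 -> False.
Proof.
case=> _ _ _ _ _ /sgz_eqN1 /= q1 _ a1_gt0 lt_a12 lt_a23 lt1 lt2 lt3.
have : sym3 a1 a2 a3 * sym2 g1 g2 g3 <= sym2 a1 a2 a3 * sym3 g1 g2 g3.
  by apply: sym21_le; lra.
by lra.
Qed.

Lemma Sigma2122_not_inner (a1 a2 a3 g1 g2 g3 : R) :
    pattern_of_moduli [:: a1; a2; a3] [:: g1; g2; g3] = Sigma [:: 2; 1; 2; 2] ->
    0 < a1 -> a1 < a2 -> a2 < a3 -> g1 < g2 -> g2 < g3 ->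
  a1 < g1 -> g3 < a3 -> False.
Proof.
case=> _ /sgz_eq1 /= q5 _ _ _ /sgz_eqN1 /= q1 _.
move=> a1_gt0 lt_a12 lt_a23 lt_g12 lt_g23 lt1 lt3.
have : sym3 a1 a2 a3 * sym2 g1 g2 g3 <= sym2 a1 a2 a3 * sym3 g1 g2 g3.
  by apply: inner_triple_le; lra.
by lra.
Qed.

(** The lexicographic listing fixes the order in which [order_cases] produces its goals. *)
Lemma compatible_caseP Omega :
    count_mem P Omega = 3%N -> count_mem N Omega = 3%N ->
  Omega \in [::
     [:: P; P; P; N; N; N]; [:: P; P; N; P; N; N]; [:: P; P; N; N; P; N];
     [:: P; P; N; N; N; P]; [:: P; N; P; P; N; N]; [:: P; N; P; N; P; N];
     [:: P; N; P; N; N; P]; [:: P; N; N; P; P; N]; [:: P; N; N; P; N; P];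
     [:: P; N; N; N; P; P]; [:: N; P; P; P; N; N]; [:: N; P; P; N; P; N];
     [:: N; P; P; N; N; P]; [:: N; P; N; P; P; N]; [:: N; P; N; P; N; P];
     [:: N; P; N; N; P; P]; [:: N; N; P; P; P; N]; [:: N; N; P; P; N; P];
     [:: N; N; P; N; P; P]; [:: N; N; N; P; P; P]].
Proof.
move=> hP hN; have /compatible_orders := conj hP hN.
by set s1 := permutations _; set s2 := (X in _ -> _ \in X);
   have /perm_mem-> : perm_eq s1 s2.
Qed.

Lemma realizable_moduli6 sigma Omega :
    head 0 sigma = 1 -> 0 \notin sigma ->
    count_mem P Omega = 3%N -> count_mem N Omega = 3%N ->
  realizable R 6 sigma Omega ->
  exists x1 x2 x3 x4 x5 x6 : R,
   [/\ 0 < x1, [/\ x1 < x2, x2 < x3, x3 < x4, x4 < x5 & x5 < x6]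
     & let m := [:: x1; x2; x3; x4; x5; x6] in
       pattern_of_moduli (moduli_of_letter P Omega m)
                         (moduli_of_letter N Omega m) = sigma].
Proof.
move=> hd nz hP hN /realizableP[] // m [].
case: m => [|x1 [|x2 [|x3 [|x4 [|x5 [|x6 []]]]]]] // _.
move=> /andP[x1_gt0 _] /and5P[? ? ? ? /andP[? _]] pat.
by exists x1, x2, x3, x4, x5, x6.
Qed.

Ltac order_cases hP hN :=
  have := compatible_caseP hP hN; rewrite 20!inE;
  do 19?[case/orP=> [/eqP-> //=|]]; last move=> /eqP-> //=.

Ltac moduli_of_realizable :=
  move=> /realizable_moduli6[] //;
  move=> x1 [x2 [x3 [x4 [x5 [x6 [? [? ? ? ? ?] /= pat]]]]]].

Ltac witness_with ms :=
  apply/realizableP => //; exists ms;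
  rewrite /pattern_of_moduli; split=> //=; [lra | lra |];
  congr [:: _; _; _; _; _; _; _];
  first [apply: gtr0_sgz; lra | apply: ltr0_sgz; lra].

Lemma realizable3121 Omega :
    count_mem P Omega = 3%N -> count_mem N Omega = 3%N ->
  realizable R 6 (Sigma [:: 3; 1; 2; 1]) Omega <->
     Omega \in [:: [:: P; P; P; N; N; N];
                   [:: P; P; N; P; N; N];
                   [:: P; P; N; N; P; N];
                   [:: P; N; P; P; N; N];
                   [:: N; P; P; P; N; N]].
Proof.
move=> hP hN; split; last first.
{ rewrite !inE => /orP[|/or4P[]] /eqP->.
  witness_with [:: 2; 3; 4; 5; 10; 11 : R].
  witness_with [:: 1; 2; 3; 4; 8; 10 : R].
  (* The roots 7, 9, 22, -19, -21 give the degree 5 pattern (+,+,-,+,+,-); the factor x + 504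
     prefixes a plus. *)
  witness_with [:: 7; 9; 19; 21; 22; 504 : R].
  witness_with [:: 1; 2; 3; 4; 11; 13 : R].
  witness_with [:: 2; 3; 4; 5; 18; 20 : R]. }
moduli_of_realizable; move: pat; rewrite /moduli_of_letter;
  order_cases hP hN => pat; exfalso.
(* The listed orders are closed by computation. Of the other 15, the ten ending in P have g3 < a3,
   and the remaining five have g1 < a2 and g2 < a3. *)
all: first [apply: (pattern_ppp_max pat); lra
           |apply: (pattern_ppp_pair pat); lra].
Qed.

Lemma realizable2122 Omega :
    count_mem P Omega = 3%N -> count_mem N Omega = 3%N ->
  realizable R 6 (Sigma [:: 2; 1; 2; 2]) Omega <->
     Omega \in [:: [:: P; N; N; P; P; N];
                   [:: N; P; P; P; N; N];
                   [:: N; P; P; N; P; N];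
                   [:: N; P; P; N; N; P];
                   [:: N; P; N; P; P; N];
                   [:: N; N; P; P; P; N]].
Proof.
move=> hP hN; split; last first.
{ rewrite !inE => /orP[|/orP[|/or4P[]]] /eqP->.
  witness_with [:: 4; 5; 6; 11; 12; 17 : R].
  witness_with [:: 1; 4; 5; 6; 7; 8 : R].
  witness_with [:: 1; 3; 4; 5; 6; 8 : R].
  witness_with [:: 1; 5; 7; 13; 14; 15 : R].
  witness_with [:: 1; 2; 3; 4; 5; 8 : R].
  witness_with [:: 1; 2; 3; 4; 5; 10 : R]. }
moduli_of_realizable; move: pat; rewrite /moduli_of_letter;
  order_cases hP hN => pat; exfalso.
(* Five orders have all g_i < a_i, five have all a_i < g_i, and the last four both begin and end
   with P. *)
all: first [apply: (pattern_pp_not_dominated pat); lra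
           |apply: (Sigma2122_not_dominating pat); lra
           |apply: (Sigma2122_not_inner pat); lra].
Qed.

Lemma realizable2221 Omega :
    count_mem P Omega = 3%N -> count_mem N Omega = 3%N ->
  realizable R 6 (Sigma [:: 2; 2; 2; 1]) Omega <->
     Omega \notin [:: [:: N; P; N; P; N; P];
                      [:: N; P; N; N; P; P];
                      [:: N; N; P; P; N; P];
                      [:: N; N; P; N; P; P];
                      [:: N; N; N; P; P; P]].
Proof.
move=> hP hN; split; last first.
{ order_cases hP hN => _.
  (* The witnesses follow the listing of [compatible_caseP]; the five excluded orders contradict the
     premise by computation. *)
  witness_with [:: 1; 2; 3; 4; 5; 6 : R].
  witness_with [:: 1; 2; 3; 4; 5; 6 : R].
  witness_with [:: 1; 2; 3; 4; 5; 6 : R].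
  witness_with [:: 1; 2; 3; 4; 5; 6 : R].
  witness_with [:: 1; 2; 3; 4; 5; 6 : R].
  witness_with [:: 1; 2; 3; 4; 5; 6 : R].
  witness_with [:: 1; 2; 3; 4; 5; 6 : R].
  witness_with [:: 1; 2; 3; 4; 5; 6 : R].
  witness_with [:: 1; 4; 5; 6; 7; 8 : R].
  witness_with [:: 1; 6; 7; 8; 9; 10 : R].
  witness_with [:: 3; 4; 5; 6; 7; 8 : R].
  witness_with [:: 3; 4; 5; 8; 9; 10 : R].
  witness_with [:: 5; 6; 7; 10; 11; 12 : R].
  witness_with [:: 5; 6; 7; 8; 9; 17 : R].
  witness_with [:: 9; 10; 11; 12; 13; 26 : R]. }
moduli_of_realizable; move: pat; rewrite /moduli_of_letter;
  order_cases hP hN => pat; exfalso.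
(* The five excluded orders are exactly those with g_i < a_i for all i. *)
all: by apply: (pattern_pp_not_dominated pat); lra.
Qed.

Lemma realizable3211 Omega :
    count_mem P Omega = 3%N -> count_mem N Omega = 3%N ->
  realizable R 6 (Sigma [:: 3; 2; 1; 1]) Omega <->
     Omega \in [:: [:: P; P; P; N; N; N];
                   [:: P; P; N; P; N; N];
                   [:: P; P; N; N; P; N];
                   [:: P; N; P; P; N; N]].
Proof.
move=> hP hN; split; last first.
{ rewrite !inE => /or4P[] /eqP->.
  witness_with [:: 1; 2; 3; 4; 6; 7 : R].
  witness_with [:: 1; 2; 3; 4; 9; 10 : R].
  (* Here 2, 3, 16, -14, -15 give (+,+,-,-,+,-), and x + 40 prefixes a plus. *)
  witness_with [:: 2; 3; 14; 15; 16; 40 : R].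
  witness_with [:: 1; 7; 8; 9; 28; 32 : R]. }
moduli_of_realizable; move: pat; rewrite /moduli_of_letter;
  order_cases hP hN => pat; exfalso.
(* The first two lemmas act as for [realizable3121]; only NPPPNN is left to the third. *)
all: first [apply: (pattern_ppp_max pat); lra
           |apply: (pattern_ppp_pair pat); lra
           |apply: (Sigma3211_min pat); lra].
Qed.

End SignPatterns.

Theorem theorem1 (R : realType) (Omega : seq letter)
    (hP : count_mem P Omega = 3) (hN : count_mem N Omega = 3) :
  (realizable R 6 (Sigma [:: 3; 1; 2; 1]) Omega <->
     Omega \in [:: [:: P; P; P; N; N; N];
                   [:: P; P; N; P; N; N];
                   [:: P; P; N; N; P; N];
                   [:: P; N; P; P; N; N];
                   [:: N; P; P; P; N; N]])
  /\
  (realizable R 6 (Sigma [:: 2; 1; 2; 2]) Omega <->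
     Omega \in [:: [:: P; N; N; P; P; N];
                   [:: N; P; P; P; N; N];
                   [:: N; P; P; N; P; N];
                   [:: N; P; P; N; N; P];
                   [:: N; P; N; P; P; N];
                   [:: N; N; P; P; P; N]])
  /\
  (realizable R 6 (Sigma [:: 2; 2; 2; 1]) Omega <->
     Omega \notin [:: [:: N; P; N; P; N; P];
                      [:: N; P; N; N; P; P];
                      [:: N; N; P; P; N; P];
                      [:: N; N; P; N; P; P];
                      [:: N; N; N; P; P; P]])
  /\
  (realizable R 6 (Sigma [:: 3; 2; 1; 1]) Omega <->
     Omega \in [:: [:: P; P; P; N; N; N];
                   [:: P; P; N; P; N; N];
                   [:: P; P; N; N; P; N];
                   [:: P; N; P; P; N; N]]).
Proof.
split; first exact: realizable3121.
split; first exact: realizable2122.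
split; first exact: realizable2221.
exact: realizable3211.
Qed.
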